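(* Let $a,b$ be non-negative integers, $t$ a positive integer, and $p$ a prime. Then: (1) if $p>t$, $$S_{p-1}^q(\{1\}^t)\equiv -K_t(p)(1-q)^t \pmod{[p]_q};$$ (2) if $p>2t+1$, $$S_{p-1}^q(1,\{2\}^{t-1},1)\equiv (1-q)^{2t}\sum_{j=0}^t\left(t\binom{t-1}{j}+(t-1)\binom{t}{j}\right)(-1)^{j+1}K_{2t-j}(p) \pmod{[p]_q};$$ (3) if $p>2(a+b+1)+1$, $$S_{p-1}^q(\{1\}^{a},2,\{1\}^{b})+S_{p-1}^q(\{1\}^{b},2,\{1\}^{a})\equiv (1-q)^{a+b+2}\bigl(K_{a+b+1}(p)-K_{a+b+2}(p)-K_{a+1}(p)K_{b+1}(p)\bigr) \pmod{[p]_q}.$$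
   Context: Here $q$ is an indeterminate and $[n]_q=\frac{1-q^n}{1-q}=1+q+\cdots+q^{n-1}$. For positive integers $s_1,\dots,s_l$, $$S_n^q(s_1,\ldots,s_l)=\sum_{1\le k_1\le\cdots\le k_l\le n}\prod_{i=1}^l\frac{q^{(s_i-1)k_i}}{[k_i]_q^{s_i}}.$$ $\{s\}^t$ denotes $t\ge0$ consecutive copies of $s$. The rational numbers $K_n(p)$ ($n\ge0$) are defined by the expansion about $z=1$ $$\frac{p(z-1)}{z^p-1}=\sum_{n=0}^{\infty}(-1)^{n-1}K_n(p)(z-1)^n$$ (so $K_0(p)=-1$, $K_1(p)=-\frac{p-1}{2}$, $K_2(p)=-\frac{p^2-1}{12}$). For a prime $p$ and rational functions $A,B$ in $q$, $A\equiv B\pmod{[p]_q}$ means $A-B=f/g$ with $f,g$ polynomials in $q$ with integer coefficients, $g$ coprime to $[p]_q$ in $\mathbb{Q}[q]$, and $[p]_q\mid f$ ($[p]_q$ is the $p$th cyclotomic polynomial, irreducible over $\mathbb{Q}$). *)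

(* Defs.v *)
From HB Require Import structures.
From mathcomp Require Import all_boot all_order all_algebra.

Set Implicit Arguments.
Unset Strict Implicit.
Unset Printing Implicit Defensive.

Import GRing.Theory.
Local Open Scope ring_scope.

(* The field Q(q). *)
Notation ratfun := {fraction {poly rat}}.

Definition polyF (f : {poly rat}) : ratfun := tofrac f.

Definition qvar : ratfun := polyF 'X.

Definition constF (c : rat) : ratfun := polyF c%:P.

Definition intpoly (f : {poly int}) : {poly rat} := map_poly intr f.

Definition qbracket (n : nat) : {poly int} := \sum_(i < n) 'X^i.

Definition qbracketF (n : nat) : ratfun := polyF (intpoly (qbracket n)).

Lemma qbracketE n : qbracketF n = (1 - qvar ^+ n) / (1 - qvar).
Proof.
have polyFE : polyF = @tofrac _ by [].
have nz : 1 - qvar != 0.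
  rewrite /qvar polyFE -tofrac1 -tofracB tofrac_eq0 subr_eq0 eq_sym.
  by apply/eqP => /(congr1 (fun f : {poly rat} => size f)); rewrite size_polyX size_poly1.
apply: (canRL (mulfK nz)).
rewrite /qbracketF /intpoly /qbracket rmorph_sum /=.
under eq_bigr do rewrite map_polyXn.
rewrite -opprB -(opprB (qvar ^+ n)) mulrN; congr (- _).
by rewrite /qvar polyFE -tofrac1 -!tofracXn -!tofracB -tofracM subrX1 mulrC.
Qed.

(* [path leq 1 k] says 1 <= k_1 <= ... <= k_l.  The subtraction s_i - 1 is
   truncated, which is harmless for the positive s_i considered here. *)
Definition qS (n : nat) (s : seq nat) : ratfun :=
  \sum_(k : (size s).-tuple 'I_n.+1 | path leq 1%N [seq val x | x <- k])
    \prod_(i < size s)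
      (qvar ^+ ((nth 0%N s i - 1) * tnth k i)
         / qbracketF (tnth k i) ^+ nth 0%N s i).

(* N / D = \sum_n c_n (z - a)^n, as the identity N = D * \sum_n c_n (z - a)^n
   in F[[z - a]]: the coefficient of (z - a)^m in a polynomial P of z is
   (P \Po ('X + a%:P))`_m. *)
Definition expansion_at (F : fieldType) (a : F) (N D : {poly F})
    (c : nat -> F) : Prop :=
  forall n, (N \Po ('X + a%:P))`_n
            = \sum_(i < n.+1) c i * (D \Po ('X + a%:P))`_(n - i).

(* (-1)^(n-1) is written (-1)^(n+1), so that n = 0 is not special. *)
Definition is_Kseq (p : nat) (K : nat -> rat) : Prop :=
  expansion_at 1 (p%:R *: ('X - 1)) ('X^p - 1)
    (fun n => (-1) ^+ n.+1 * K n).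

Definition eqmod_qbracket (p : nat) (A B : ratfun) : Prop :=
  exists f g h : {poly int},
    [/\ A - B = polyF (intpoly f) / polyF (intpoly g),
        coprimep (intpoly g) (intpoly (qbracket p))
      & f = qbracket p * h].

Lemma Kseq_coefN p n : ((p%:R *: ('X - 1)) \Po ('X + 1%:P) : {poly rat})`_n
                     = p%:R *+ (n == 1%N).
Proof.
rewrite linearZ /= linearB /= comp_polyX -[X in _ - (X \Po _)]polyC1 comp_polyC.
by rewrite addrK coefZ coefX mulr_natr.
Qed.

Lemma Kseq_coefD p n : (('X^p - 1) \Po ('X + 1%:P) : {poly rat})`_n
                     = 'C(p, n)%:R - (n == 0%N)%:R.
Proof.
rewrite linearB /= comp_Xn_poly -[X in _ - (X \Po _)]polyC1 comp_polyC coefB.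
rewrite polyC1 coef1; congr (_ - _).
rewrite addrC exprDn coef_sum; under eq_bigr do rewrite expr1n mul1r coefMn coefXn.
have [lt_np|le_pn] := ltnP n p.+1.
  rewrite (bigD1 (Ordinal lt_np)) //= eqxx big1 ?addr0 // => i ne_in.
  by rewrite eq_sym -[_ == n]/(i == Ordinal lt_np) (negPf ne_in) mul0rn.
rewrite bin_small // big1 // => i _.
by rewrite gtn_eqF ?mul0rn // (leq_trans (ltn_ord i)).
Qed.

Lemma is_KseqP p K : (0 < p)%N ->
  is_Kseq p K <->
  (forall n, (-1) ^+ n.+1 * K n * p%:R
     = p%:R *+ (n == 0%N) - \sum_(i < n) (-1) ^+ i.+1 * K i * 'C(p, n.+1 - i)%:R).
Proof.
move=> p_gt0; rewrite /is_Kseq /expansion_at.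
have recE n : \sum_(i < n.+2) (-1) ^+ i.+1 * K i
      * (('X^p - 1) \Po ('X + 1%:P) : {poly rat})`_(n.+1 - i)
    = \sum_(i < n) (-1) ^+ i.+1 * K i * 'C(p, n.+1 - i)%:R
      + (-1) ^+ n.+1 * K n * p%:R.
  rewrite big_ord_recr big_ord_recr /= subnn subSnn !Kseq_coefD bin0 bin1.
  rewrite !eqxx subrr mulr0 addr0 subr0; congr (_ + _).
  apply: eq_bigr => i _; rewrite Kseq_coefD subSn ?subr0 //; exact: ltnW.
split=> [expK n | recK [|n]].
- by have := expK n.+1; rewrite recE Kseq_coefN eqSS => ->; rewrite addrC addKr.
- by rewrite big_ord_recr big_ord0 /= Kseq_coefN Kseq_coefD bin0 subrr mulr0 addr0.
- by rewrite recE Kseq_coefN eqSS recK addrC subrK.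
Qed.

Lemma Kseq_unique p K K' : (0 < p)%N -> is_Kseq p K -> is_Kseq p K' -> K =1 K'.
Proof.
move=> p_gt0 /(is_KseqP _ p_gt0) recK /(is_KseqP _ p_gt0) recK' n.
have p_nz : p%:R != 0 :> rat by rewrite Num.Theory.pnatr_eq0 -lt0n.
elim/ltn_ind: n => n IHn.
apply: (mulfI (_ : (-1) ^+ n.+1 != 0 :> rat)); first by rewrite signr_eq0.
apply: (mulIf p_nz); rewrite recK recK'; congr (_ - _).
by apply: eq_bigr => i _; rewrite IHn.
Qed.

Lemma Kseq_exists p : (0 < p)%N -> exists K, is_Kseq p K.
Proof.
move=> p_gt0.
have p_nz : p%:R != 0 :> rat by rewrite Num.Theory.pnatr_eq0 -lt0n.
pose next (l : seq rat) := (-1) ^+ (size l).+1 * ((p%:R *+ (size l == 0%N)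
  - \sum_(i < size l) (-1) ^+ i.+1 * l`_i * 'C(p, (size l).+1 - i)%:R) / p%:R).
pose L n := iter n (fun l => rcons l (next l)) [::].
have sizeL n : size (L n) = n by elim: n => //= n IHn; rewrite size_rcons IHn.
have nthL n i : (i < n)%N -> (L n)`_i = next (L i).
  elim: n => // n IHn; rewrite ltnS leq_eqVlt /= nth_rcons sizeL => /predU1P[->|lt_in].
    by rewrite ltnn eqxx.
  by rewrite lt_in IHn.
exists (fun n => next (L n)); apply/(is_KseqP _ p_gt0) => n.
rewrite {1}/next sizeL signrMK divfK //; congr (_ - _).
by apply: eq_bigr => i _; rewrite nthL.
Qed.

Lemma Kseq_first p K : (0 < p)%N -> is_Kseq p K ->
  K 0%N = -1 /\ K 1%N = - ((p%:R - 1) / 2).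
Proof.
move=> p_gt0 /(is_KseqP _ p_gt0) recK.
have p_nz : p%:R != 0 :> rat by rewrite Num.Theory.pnatr_eq0 -lt0n.
have K0 : K 0%N = -1.
  have := recK 0%N; rewrite big_ord0 subr0 expr1 -{2}[p%:R]mul1r => /(mulIf p_nz).
  by rewrite mulN1r => <-; rewrite opprK.
split=> //; have := recK 1%N; rewrite big_ord1 K0 sqrrN expr1n mul1r /= expr1.
rewrite mulrNN !mul1r mulr0n sub0r subn0 => K1; apply: (mulIf p_nz); rewrite K1.
rewrite mulNr; congr (- _).
have two_nz : 2 != 0 :> rat by [].
have bin2E : ('C(p, 2) * 2 = p.-1 * p)%N.
  rewrite bin2 muln2 halfK [RHS]mulnC.
  by case: (p) p_gt0 => // m _; rewrite oddM /= andNb subn0.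
apply: (mulIf two_nz).
by rewrite -natrM bin2E natrM mulrAC divfK // -subn1 natrB.
Qed.

(* Main.v *)
(* Let z be a primitive p-th root of unity, x_k = 1/(1 - z^k) and
   y_k = x_k - 1 = z^k x_k.  Since [p]_q is the minimal polynomial of z, a
   congruence modulo [p]_q is an equality of values at q = z, and there the
   factor q^((s-1)k)/[k]_q^s becomes (1 - z)^s x_k y_k^(s-1).

   Duality.  Let c(m,i) be the connector (a q-binomial coefficient at q = 1/z) and
   transform g into f_m = sum_(1 <= i <= m) c(m,i) g_i.  Multiplying g by x
   amounts to summing x_k f_k over k <= m, and multiplying f by y amounts to
   summing y_j g_j over j <= i.  As c(p-1,i) = z^i, each multiple sum turns into
   its Hoffman dual: {1}^t gives the power sums sum_i z^i x_i^t, which are the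
   K_t(p); ({1}^a,2,{1}^b) gives a double sum, symmetrised by the shuffle
   of its two indices; and (1,{2}^(t-1),1) gives the complete homogeneous
   symmetric function h_t of the x_k y_k.

   The generating function of the latter has double poles, since
   x_k y_k = x_(p-k) y_(p-k); with U = (v-1)^2/v it is expanded in
   partial fractions through sum_i v z^i/(1 - v z^i)^2 = p^2 v^p/(1 - v^p)^2,
   so that h_t is again a combination of power sums. *)
Require Import Defs.
From mathcomp Require Import all_boot all_order all_algebra all_field.
From mathcomp Require Import ring zify.
Import GRing.Theory Num.Theory.
Local Open Scope ring_scope.

(** * Duality at a root of unity *)

Definition psum {F : fieldType} (phi f : nat -> F) (m : nat) : F :=
  \sum_(1 <= k < m.+1) phi k * f k.

Lemma psum0 (F : fieldType) (phi f : nat -> F) : psum phi f 0 = 0.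
Proof. by rewrite /psum big_geq. Qed.

Lemma psumS (F : fieldType) (phi f : nat -> F) m :
  psum phi f m.+1 = psum phi f m + phi m.+1 * f m.+1.
Proof. by rewrite /psum big_nat_recr. Qed.

Lemma eq_psum (F : fieldType) (phi f g : nat -> F) m :
  (forall k, (0 < k <= m)%N -> f k = g k) -> psum phi f m = psum phi g m.
Proof. by move=> fg; apply: eq_big_nat => k lek; rewrite fg. Qed.

Lemma psumZ (F : fieldType) (phi f : nat -> F) (c : F) m :
  psum phi (fun k => c * f k) m = c * psum phi f m.
Proof. by rewrite /psum mulr_sumr; apply: eq_bigr => k _; rewrite mulrCA. Qed.

Definition rx {F : fieldType} (z : F) (k : nat) : F := (1 - z ^+ k)^-1.
Definition ry {F : fieldType} (z : F) (k : nat) : F := rx z k - 1.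

(* Up to sign and a power of z, the q-binomial coefficient (m choose j) at
   q = 1/z. *)
Definition connector {F : fieldType} (z : F) (m j : nat) : F :=
  \prod_(i < j) ((z ^- i - z ^- m) / (z ^- i.+1 - 1)).

Definition connected {F : fieldType} (z : F) (p : nat) (f g : nat -> F) : Prop :=
  forall m, (0 < m < p)%N -> f m = \sum_(1 <= i < m.+1) connector z m i * g i.

Definition letter {F : fieldType} (z : F) (s k : nat) : F :=
  rx z k * ry z k ^+ (s - 1).

(** The fold sums over the smallest index first. The seed [f] is arbitrary because the duality runs
    letter by letter and changes it at each step. *)
Definition wsum {F : fieldType} (phi : nat -> nat -> F) (f : nat -> F)
    (s : seq nat) : nat -> F :=
  foldl (fun f si => psum (phi si) f) f s.

Lemma eq_wsum (F : fieldType) (phi : nat -> nat -> F) f f' s m : (0 < m)%N ->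
  (forall k, (0 < k <= m)%N -> f k = f' k) -> wsum phi f s m = wsum phi f' s m.
Proof.
move=> m0; elim: s f f' => [|s0 s IHs] f f' ff' /=; first by apply: ff'; lia.
by apply: IHs => k km; apply: eq_psum => j jk; apply: ff'; lia.
Qed.

Lemma wsumZ (F : fieldType) (phi : nat -> nat -> F) c f s m : (0 < m)%N ->
  wsum phi (fun k => c * f k) s m = c * wsum phi f s m.
Proof.
move=> m0; elim: s f => //= s0 s IHs f; rewrite -IHs; apply: eq_wsum => // k _.
exact: psumZ.
Qed.

(** The dual of [wsum (letter z)]: a letter [s] stands for x y^(s-1), whose y's become summations
    and whose x becomes a multiplication. *)
Definition dsum {F : fieldType} (z : F) (g : nat -> F) (s : seq nat) : nat -> F :=
  foldl (fun g si i => rx z i * iter (si - 1) (psum (ry z)) g i) g s.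

Definition rootsum {F : fieldType} (z : F) (p n : nat) : F :=
  \sum_(1 <= i < p) z ^+ i * rx z i ^+ n.

Section Duality.

Variables (F : fieldType) (p : nat) (z : F).
Hypothesis prim_z : p.-primitive_root z.

Lemma prim_neq0 : z != 0.
Proof.
apply/eqP => z0; have /eqP := prim_expr_order prim_z.
by rewrite z0 expr0n gtn_eqF ?(prim_order_gt0 prim_z) // eq_sym oner_eq0.
Qed.

Lemma expr_neq1 k : (0 < k < p)%N -> z ^+ k != 1.
Proof.
case/andP=> k0 kp; rewrite -(prim_order_dvd prim_z).
by apply: contraTN kp => /dvdn_leq -/(_ k0); rewrite -leqNgt.
Qed.

Lemma subr_expr_neq0 k : (0 < k < p)%N -> 1 - z ^+ k != 0.
Proof. by move=> kp; rewrite subr_eq0 eq_sym expr_neq1. Qed.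

Lemma ryE k : (0 < k < p)%N -> ry z k = z ^+ k * rx z k.
Proof. by move=> /subr_expr_neq0 nz; rewrite /ry /rx; field. Qed.

(** The reflection k -> p - k inverts z^k. It exchanges x with -y and so fixes x y. *)
Lemma rx_rev k : (0 < k < p)%N -> rx z (p - k) = - ry z k.
Proof.
move=> kp; rewrite /ry /rx.
have -> : z ^+ (p - k) = (z ^+ k)^-1.
  apply: (mulIf (expf_neq0 k prim_neq0)).
  by rewrite -exprD subnK ?(prim_expr_order prim_z) ?mulVf ?expf_neq0 ?prim_neq0 //; lia.
have nz := subr_expr_neq0 k kp; have zk := expf_neq0 k prim_neq0.
have nz' : z ^+ k - 1 != 0 by rewrite -opprB oppr_eq0.
by field; rewrite nz zk nz'.
Qed.

Lemma ry_rev k : (0 < k < p)%N -> ry z (p - k) = - rx z k.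
Proof. by move=> kp; rewrite /ry rx_rev // /ry; ring. Qed.

Lemma ryV k : (0 < k < p)%N -> ry z k = (z ^- k - 1)^-1.
Proof.
move=> kp; rewrite ryE // /rx.
have nz := subr_expr_neq0 k kp; have zk := expf_neq0 k prim_neq0.
by field; rewrite zk mulN1r nz.
Qed.

Lemma invexpr_sub1_neq0 k : (0 < k < p)%N -> z ^- k - 1 != 0.
Proof.
by move=> kp; rewrite subr_eq0 -exprVn -(inj_eq invr_inj) exprVn invrK invr1 expr_neq1.
Qed.

Lemma connectorS m j : connector z m j.+1 =
  connector z m j * ((z ^- j - z ^- m) / (z ^- j.+1 - 1)).
Proof. exact: big_ord_recr. Qed.

Lemma connector_gt m j : (m < j)%N -> connector z m j = 0.
Proof.
by move=> lt_mj; rewrite /connector (bigD1 (Ordinal lt_mj)) //= subrr !mul0r.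
Qed.

(** A difference equation in the upper index, read off from the ratio of the connectors at [m.+1]
    and [m]. *)
Lemma connectorB m j : (0 < j < p)%N -> (m.+1 < p)%N ->
  (connector z m.+1 j - connector z m j) * rx z j = rx z m.+1 * connector z m.+1 j.
Proof.
move=> jp mp; have nzj := subr_expr_neq0 j jp.
have nzm : 1 - z ^+ m.+1 != 0.
  by apply: subr_expr_neq0.
have zk k : z ^+ k != 0 by rewrite expf_neq0 ?prim_neq0.
(* Shifting [m] carries each numerator to the next one up to a factor 1/z. The ratio is
   cross-multiplied so that it also covers i = m + 1, where both sides vanish. *)
have key i : (i < p)%N -> connector z m i * z ^- i * (z ^- m.+1 - 1)
    = connector z m.+1 i * (z ^- m.+1 - z ^- i).
  elim: i => [|i IHi] ip.
    by rewrite /connector !big_ord0 expr0 invr1; ring.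
  rewrite !connectorS.
  have nzi := invexpr_sub1_neq0 i.+1 ip.
  have -> : connector z m i * ((z ^- i - z ^- m) / (z ^- i.+1 - 1)) * z ^- i.+1
      * (z ^- m.+1 - 1)
    = (connector z m i * z ^- i * (z ^- m.+1 - 1)) * ((z ^- i - z ^- m) * z^-1)
       / (z ^- i.+1 - 1) by rewrite exprSr invfM; ring.
  rewrite IHi 1?ltnW // mulrBl -!invfM -!exprSr; ring.
have {key} : connector z m j * (1 - z ^+ m.+1)
    = connector z m.+1 j * (z ^+ j - z ^+ m.+1).
  have /andP[_ /key] := jp.
  move/(congr1 (fun u => z ^+ j * z ^+ m.+1 * u)).
  have -> : z ^+ j * z ^+ m.+1 * (connector z m j * z ^- j * (z ^- m.+1 - 1))
     = connector z m j * (1 - z ^+ m.+1) by field; rewrite !zk.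
  by move=> ->; field; rewrite !zk.
move/(canRL (mulfK nzm)) => ->; rewrite /rx; field.
by rewrite nzj nzm.
Qed.

(** Because z^-(p-1) = z, every factor of the product equals z. *)
Lemma connector_last j : (j < p)%N -> connector z p.-1 j = z ^+ j.
Proof.
elim: j => [|j IHj] ltjp; first by rewrite /connector big_ord0.
rewrite connectorS IHj 1?ltnW // [RHS]exprSr; congr (_ * _).
have nz := invexpr_sub1_neq0 j.+1 ltjp.
apply: (canLR (mulfK nz)).
have -> : z ^- p.-1 = z.
  rewrite -[RHS]invrK; congr _^-1; apply: (mulfI prim_neq0).
  by rewrite -exprS prednK ?(prim_expr_order prim_z) ?mulfV ?prim_neq0 //; lia.
rewrite mulrBr mulr1; congr (_ - _).
by rewrite exprS invfM mulrA mulfV ?prim_neq0 // mul1r.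
Qed.

(** After multiplication by z^-m - 1 the sum over [i] telescopes, and its upper end vanishes by
    [connector_gt]. *)
Lemma connector_sum m j : (0 < j <= m)%N -> (m < p)%N ->
  ry z m * connector z m j = ry z j * \sum_(j <= i < m.+1) connector z m i.
Proof.
move=> /andP[j0 jm] mp; have m0 := leq_trans j0 jm.
have step i : (j <= i < m.+1)%N ->
    connector z m i * (z ^- m - 1) = connector z m i * (z ^- i - 1)
      - connector z m i.+1 * (z ^- i.+1 - 1).
  move=> /andP[ji im]; rewrite connectorS.
  (* The top index is treated apart: i + 1 may be p there, and then the denominator z^-(i+1) - 1 is
     zero. *)
  have [->|ne_im] := eqVneq i m; first by rewrite subrr mul0r mulr0 mul0r subr0.
  have nz : z ^- i.+1 - 1 != 0 by apply: invexpr_sub1_neq0; lia.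
  by rewrite -[_ * (_ / _) * _]mulrA divfK //; ring.
have sumE : (\sum_(j <= i < m.+1) connector z m i) * (z ^- m - 1)
    = connector z m j * (z ^- j - 1).
  rewrite mulr_suml (eq_big_nat _ _ step).
  rewrite (telescope_sumr_eq (fun i => - (connector z m i * (z ^- i - 1)))) 1?leqW //.
    by rewrite connector_gt // mul0r oppr0 sub0r opprK.
  by move=> i _; ring.
have nzm : z ^- m - 1 != 0 by apply: invexpr_sub1_neq0; lia.
have nzj : z ^- j - 1 != 0 by apply: invexpr_sub1_neq0; lia.
rewrite !ryV; [|lia..]; apply: (mulIf nzm); rewrite -[RHS]mulrA sumE.
by rewrite mulrAC mulVf // mul1r mulrCA mulVf // mulr1.
Qed.

(** This is [connector_sum] at j = 1, where the connector is a single factor. The pair is the seed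
    of the duality. *)
Lemma connected_const : connected z p (fun=> -1) (fun=> 1).
Proof.
move=> m /andP[m0 mp]; have z1 : z ^- 1 - 1 != 0 by apply: invexpr_sub1_neq0; lia.
under eq_bigr do rewrite mulr1.
have nz : ry z 1 != 0 by rewrite ryV ?invr_eq0 //; lia.
apply: (mulfI nz); rewrite -connector_sum ?ryV; [|lia..].
rewrite /connector big_ord1 expr0 invr1.
have nzm : z ^- m - 1 != 0 by apply: invexpr_sub1_neq0; lia.
by rewrite mulrN1 mulrA -[1 - _]opprB mulrN mulVf // mulN1r.
Qed.

(** By induction on [m]: the increment is [connectorB], and the sum extends freely to i = m + 1,
    where the connector vanishes. *)
Lemma connected_psum f g : connected z p f g ->
  connected z p (psum (rx z) f) (fun i => rx z i * g i).
Proof.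
move=> fg m /andP[_]; elim: m => [|m IHm] mp; first by rewrite psum0 big_geq.
rewrite psumS IHm 1?ltnW // (fg m.+1) ?mp // mulr_sumr.
have -> : \sum_(1 <= i < m.+1) connector z m i * (rx z i * g i)
    = \sum_(1 <= i < m.+2) connector z m i * (rx z i * g i).
  by rewrite [RHS]big_nat_recr //= connector_gt // mul0r addr0.
rewrite -big_split; apply: eq_big_nat => i im /=.
rewrite [rx z m.+1 * _]mulrA -connectorB //; [ring | lia].
Qed.

(** [connector_sum] turns the factor y_m into a sum over l from i to m; exchanging the two sums
    yields the partial sums of y g. *)
Lemma connected_ry f g : connected z p f g ->
  connected z p (fun m => ry z m * f m) (psum (ry z) g).
Proof.
move=> fg m mp; rewrite fg // mulr_sumr.
rewrite (eq_big_nat _ _ (F2 := fun i =>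
  \sum_(1 <= l < m.+1 | (i <= l)%N) connector z m l * (ry z i * g i))); last first.
  move=> i im; rewrite mulrA connector_sum; [|lia..].
  rewrite mulrAC mulrC mulr_suml (big_nat_widenl i 1) //; lia.
rewrite (exchange_big_dep_nat xpredT) //=; apply: eq_big_nat => l /andP[l0 lm].
rewrite -mulr_sumr /psum; congr (_ * _).
by rewrite [RHS](big_nat_widen _ _ m.+1).
Qed.

Lemma connected_last f g : (1 < p)%N -> connected z p f g ->
  f p.-1 = \sum_(1 <= i < p) z ^+ i * g i.
Proof.
move=> p_gt1 /(_ p.-1) ->; last lia.
rewrite prednK; last lia.
by apply: eq_big_nat => i /andP[_ ip]; rewrite connector_last.
Qed.


Lemma eq_connected f f' g g' :
    (forall m, (0 < m < p)%N -> f m = f' m) ->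
    (forall m, (0 < m < p)%N -> g m = g' m) ->
  connected z p f g -> connected z p f' g'.
Proof.
move=> ff' gg' fg m mp; rewrite -ff' // fg //.
by apply: eq_big_nat => i im; rewrite gg' //; lia.
Qed.

Lemma connected_letter f g s : connected z p f g ->
  connected z p (psum (letter z s) f)
    (fun i => rx z i * iter (s - 1) (psum (ry z)) g i).
Proof.
move=> fg; have step n :
    connected z p (fun m => ry z m ^+ n * f m) (iter n (psum (ry z)) g).
  elim: n => [|n IHn].
    by apply: (eq_connected _ _ _ _ _ _ fg) => // m _; rewrite mul1r.
  by apply: (eq_connected _ _ _ _ _ _ (connected_ry _ _ IHn)) => // m _;
    rewrite exprS mulrA.
apply: (eq_connected _ _ _ _ _ _ (connected_psum _ _ (step (s - 1)%N))) => // m _.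
by apply: eq_big_nat => k _; rewrite mulrA.
Qed.

Lemma connected_wsum f g s :
  connected z p f g -> connected z p (wsum (letter z) f s) (dsum z g s).
Proof.
by elim: s f g => //= s0 s IHs f g fg; apply/IHs/connected_letter.
Qed.

(** The minus sign comes from the seed pair (-1, 1) of [connected_const]. *)
Lemma wsum_dual s : (1 < p)%N ->
  wsum (letter z) (fun=> 1) s p.-1 = - \sum_(1 <= i < p) z ^+ i * dsum z (fun=> 1) s i.
Proof.
move=> p_gt1; rewrite -(connected_last _ _ p_gt1 (connected_wsum _ _ s connected_const)).
rewrite -[wsum _ (fun=> 1) _ _]opprK; congr (- _); rewrite -[LHS]mulN1r -wsumZ; last lia.
by apply: eq_wsum => [|k _]; [lia | rewrite mulr1].
Qed.

Lemma dsum_nseq1 g n i : dsum z g (nseq n 1%N) i = rx z i ^+ n * g i.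
Proof.
elim: n g => [|n IHn] g /=; first by rewrite mul1r.
by rewrite IHn mulrA exprSr.
Qed.

(** The x left by one letter joins the y summed by the next. Keeping the seed in the form x g0 lets
    the induction close. *)
Lemma dsum_nseq2 g g0 n i : (0 < i < p)%N ->
    (forall k, (0 < k < p)%N -> g k = rx z k * g0 k) ->
  dsum z g (nseq n 2%N) i
    = rx z i * iter n (psum (fun k => rx z k * ry z k)) g0 i.
Proof.
move=> ip; elim: n g g0 => [|n IHn] g g0 gg0 /=; first exact: gg0.
rewrite (IHn _ (psum (fun k => rx z k * ry z k) g0)); first by rewrite -iterSr.
move=> k kp; congr (_ * _); apply: eq_big_nat => j jk.
by rewrite gg0; [ring | lia].
Qed.

Lemma wsum_nseq1 t : (1 < p)%N ->
  wsum (letter z) (fun=> 1) (nseq t 1%N) p.-1 = - rootsum z p t.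
Proof.
move=> p_gt1; rewrite wsum_dual //; congr (- _); apply: eq_bigr => i _.
by rewrite dsum_nseq1 mulr1.
Qed.

Lemma rootsumS n : rootsum z p n.+1 = \sum_(1 <= i < p) ry z i * rx z i ^+ n.
Proof.
by apply: eq_big_nat => i ip; rewrite ryE // exprS mulrA.
Qed.

(** The two triangles cover the square and share its diagonal. *)
Lemma sum_triangle_sym (u v : nat -> F) n :
  \sum_(1 <= i < n) u i * (\sum_(1 <= j < i.+1) v j)
    + \sum_(1 <= i < n) v i * (\sum_(1 <= j < i.+1) u j)
  = (\sum_(1 <= i < n) u i) * (\sum_(1 <= i < n) v i)
    + \sum_(1 <= i < n) u i * v i.
Proof.
elim: n => [|[|n] IHn]; first by rewrite !big_geq // mul0r.
  by rewrite !big_geq // mul0r.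
rewrite !(big_nat_recr n.+1) //= addrACA IHn; ring.
Qed.

Lemma wsum_121 a b : (1 < p)%N ->
  wsum (letter z) (fun=> 1) (nseq a 1%N ++ [:: 2%N] ++ nseq b 1%N) p.-1
  = - \sum_(1 <= i < p) (ry z i * rx z i ^+ b)
        * \sum_(1 <= j < i.+1) ry z j * rx z j ^+ a.
Proof.
move=> p_gt1; rewrite wsum_dual //; congr (- _); apply: eq_big_nat => i ip.
rewrite /dsum !foldl_cat -/(dsum _ _ _) dsum_nseq1 /= ryE //.
under eq_psum do rewrite -/(dsum z _ _) dsum_nseq1 mulr1.
rewrite /psum; ring.
Qed.

(** The square gives the product of power sums. On the diagonal, y^2 x^(a+b) = y x^(a+b+1) - y
    x^(a+b) since y = x - 1. *)
Lemma wsum_121_sym a b : (1 < p)%N ->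
  wsum (letter z) (fun=> 1) (nseq a 1%N ++ [:: 2%N] ++ nseq b 1%N) p.-1
    + wsum (letter z) (fun=> 1) (nseq b 1%N ++ [:: 2%N] ++ nseq a 1%N) p.-1
  = rootsum z p (a + b + 1) - rootsum z p (a + b + 2)
    - rootsum z p (a + 1) * rootsum z p (b + 1).
Proof.
move=> p_gt1; rewrite !wsum_121 // -opprD sum_triangle_sym.
have -> : rootsum z p (a + b + 1) - rootsum z p (a + b + 2)
    = - \sum_(1 <= i < p) (ry z i * rx z i ^+ b) * (ry z i * rx z i ^+ a).
  rewrite addn1 addn2 !rootsumS -sumrB -sumrN; apply: eq_bigr => i _.
  by rewrite exprS exprD {3}/ry; ring.
rewrite !addn1 !rootsumS opprD addrC; congr (_ - _); exact: mulrC.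
Qed.

(** The x of the last letter and the connector value z^i combine to the y_i missing for a [t]-th
    summation of x y. *)
Lemma wsum_1221 t : (1 < p)%N -> (0 < t)%N ->
  wsum (letter z) (fun=> 1) ([:: 1%N] ++ nseq (t - 1) 2%N ++ [:: 1%N]) p.-1
  = - iter t (psum (fun k => rx z k * ry z k)) (fun=> 1) p.-1.
Proof.
move=> p_gt1 t_gt0; rewrite wsum_dual //; congr (- _).
case: t t_gt0 => // t _; rewrite subSS subn0 iterS /psum prednK; last lia.
apply: eq_big_nat => i ip.
rewrite /dsum !foldl_cat -/(dsum _ _ _) /= -/(dsum z _ _).
rewrite (dsum_nseq2 _ (fun=> 1)) // ryE //; ring.
Qed.

End Duality.

(** * Coefficients of power series *)

(** A power series is kept as its coefficient sequence [c]; this is its product with a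
    polynomial. *)
Definition conv {F : fieldType} (c : nat -> F) (P : {poly F}) (n : nat) : F :=
  \sum_(i < n.+1) c i * P`_(n - i).

Section Conv.

Variable F : fieldType.
Implicit Types (c d : nat -> F) (P Q : {poly F}).

Lemma conv_coefM c P n N : (n < N)%N -> conv c P n = (\poly_(i < N) c i * P)`_n.
Proof.
move=> nN; rewrite coefM; apply: eq_bigr => i _.
by rewrite coef_poly (leq_ltn_trans _ nN) // -ltnS.
Qed.

Lemma eq_conv c d P n :
  (forall i, (i <= n)%N -> c i = d i) -> conv c P n = conv d P n.
Proof. by move=> cd; apply: eq_bigr => i _; rewrite cd // -ltnS. Qed.

Lemma convM c P Q n : conv c (P * Q) n = conv (conv c P) Q n.
Proof.
rewrite (@conv_coefM _ _ _ n.+1) // mulrA coefM; apply: eq_bigr => i _.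
by rewrite (@conv_coefM c P i n.+1).
Qed.

Lemma conv_coef P Q n : conv (fun i => P`_i) Q n = (P * Q)`_n.
Proof. by rewrite coefM. Qed.

Lemma conv_sum (I : Type) (r : seq I) (c : I -> nat -> F) P n :
  conv (fun k => \sum_(i <- r) c i k) P n = \sum_(i <- r) conv (c i) P n.
Proof.
rewrite /conv exchange_big; apply: eq_bigr => k _.
by rewrite mulr_suml.
Qed.

Lemma convD c d P n : conv (fun k => c k + d k) P n = conv c P n + conv d P n.
Proof. by rewrite -big_split; apply: eq_bigr => k _; rewrite mulrDl. Qed.

Lemma convZ (a : F) c P n : conv (fun k => a * c k) P n = a * conv c P n.
Proof. by rewrite mulr_sumr; apply: eq_bigr => k _; rewrite mulrA. Qed.

(** A polynomial with nonzero constant term is invertible as a power series, so denominators can be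
    cleared. *)
Lemma conv_inj c d P : P`_0 != 0 -> conv c P =1 conv d P -> c =1 d.
Proof.
move=> P0 cd n; elim/ltn_ind: n => n IHn; apply: (mulIf P0).
have := cd n; rewrite /conv !big_ord_recr /= subnn.
rewrite (eq_bigr (fun i : 'I_n => d i * P`_(n - i))) => [/addrI //|i _].
by rewrite IHn.
Qed.

Lemma conv_1subX c (a : F) n :
  conv c (1 - a *: 'X) n = c n - a * (if n is n'.+1 then c n' else 0).
Proof.
rewrite /conv big_ord_recr /= subnn coefB coef1 coefZ coefX /= mulr0 subr0 mulr1.
case: n => [|n]; first by rewrite big_ord0 mulr0 subr0 add0r.
rewrite big_ord_recr /= subSnn coefB coef1 coefZ coefX /= big1; first by ring.
move=> i _; rewrite coefB coef1 coefZ coefX.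
have in0 := ltn_ord i; rewrite !eqn0Ngt.
have -> : (0 < n.+1 - i)%N by lia.
have -> : (n.+1 - i == 1)%N = false by lia.
by rewrite mulr0 subr0 mulr0.
Qed.

Lemma conv1 c n : conv c 1 n = c n.
Proof. by rewrite -[1]subr0 -(scale0r 'X) conv_1subX mul0r subr0. Qed.

Lemma conv_geom (a : F) Q n :
  conv (fun i => a ^+ i) ((1 - a *: 'X) * Q) n = Q`_n.
Proof.
rewrite convM -[RHS](congr1 (fun P : {poly F} => P`_n) (mul1r Q)) -conv_coef.
apply: eq_conv => i _; rewrite conv_1subX coef1.
by case: i => [|i]; rewrite ?mulr0 ?subr0 // exprS subrr.
Qed.

Lemma convXM c P n : conv c ('X * P) n.+1 = conv c P n.
Proof.
rewrite /conv big_ord_recr /= subnn coefXM mulr0 addr0.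
by apply: eq_bigr => i _; rewrite coefXM subSn ?subn_eq0 //= -ltnS.
Qed.

(* [iter n (psum w) (fun=> 1) m] is h_n(w 1, ..., w m). *)
Lemma conv_iter_psum (w : nat -> F) m n :
  conv (fun n => iter n (psum w) (fun=> 1) m)
    (\prod_(1 <= k < m.+1) (1 - w k *: 'X)) n = (n == 0%N)%:R.
Proof.
elim: m n => [|m IHm] n.
  by rewrite big_geq // conv1; case: n => [|n] //=; rewrite psum0.
rewrite big_nat_recr //= mulrC convM -[RHS]IHm; apply: eq_conv => i _.
rewrite conv_1subX; case: i => [|i] /=; first by rewrite mulr0 subr0.
by rewrite psumS addrK.
Qed.

End Conv.

(** * Sums over the p-th roots of unity *)

Section RootSums.

Variables (F : fieldType) (p : nat) (z : F).
Hypothesis prim_z : p.-primitive_root z.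

Lemma sum_root_powers m :
  \sum_(0 <= i < p) (z ^+ i) ^+ m = p%:R *+ (p %| m)%N.
Proof.
rewrite (eq_bigr (fun i => (z ^+ m) ^+ i)) => [|i _]; last by rewrite exprAC.
rewrite (prim_order_dvd prim_z) big_mkord; have [->|ne1] := eqVneq.
  by rewrite (eq_bigr (fun=> 1)) ?sumr_const ?card_ord // => i _; rewrite expr1n.
have nz : z ^+ m - 1 != 0 by rewrite subr_eq0.
by apply: (mulfI nz); rewrite -subrX1 exprAC (prim_expr_order prim_z) expr1n subrr mulr0.
Qed.

(** The partial fraction expansion of p X / ((X + 1)^p - 1): the pole at z^j - 1 contributes -z^j /
    (1 + x_j X), a geometric series in -x_j X. *)
Lemma rootsum_expansion n : (1 < p)%N ->
  conv (fun i => (-1) ^+ i.+1 * rootsum z p i) (('X + 1) ^+ p - 1) n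
  = (p%:R *: 'X)`_n.
Proof.
move=> p_gt1.
(* [E w] is (1 - w) ((X + 1)^p - w^p) / (X + 1 - w), the cofactor of 1 + x_j X when w = z^j. *)
pose E (w : F) : {poly F} :=
  (1 - w) *: \sum_(k < p) (w ^+ k) *: ('X + 1) ^+ (p.-1 - k).
have DE j : (0 < j < p)%N ->
    ('X + 1) ^+ p - 1 = (1 - (- rx z j) *: 'X) * E (z ^+ j).
  move=> jp; have nz := subr_expr_neq0 _ _ _ prim_z j jp.
  have -> : ('X + 1 : {poly F}) ^+ p - 1 = ('X + 1) ^+ p - (z ^+ j)%:P ^+ p.
    by rewrite -rmorphXn /= exprAC (prim_expr_order prim_z) expr1n.
  rewrite subrXX /E -scalerAr scalerAl; congr (_ * _).
    rewrite scalerBr scalerA mulrN mulfV // scaleN1r opprK -alg_polyC scalerBl scale1r.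
    by rewrite -addrA addrC.
  apply: eq_bigr => k _.
  by rewrite -rmorphXn /= mulrC mul_polyC.
rewrite (eq_conv _ _ (fun i => \sum_(1 <= j < p) - z ^+ j * (- rx z j) ^+ i)); last first.
  move=> i _; rewrite mulr_sumr; apply: eq_bigr => j _.
  by rewrite [(- rx z j) ^+ i]exprNn exprS; ring.
rewrite conv_sum (eq_big_nat _ _ (F2 := fun j => - z ^+ j * (E (z ^+ j))`_n)); last first.
  by move=> j jp; rewrite convZ (DE _ jp) conv_geom.
(* The index j = 0 adds a zero term, so that j runs over all p-th roots of unity and
   [sum_root_powers] applies. *)
have -> : \sum_(1 <= j < p) - z ^+ j * (E (z ^+ j))`_n
  = (\sum_(0 <= j < p) \sum_(k < p)
      (z ^+ j ^+ k.+2 - z ^+ j ^+ k.+1) *: ('X + 1) ^+ (p.-1 - k))`_n.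
  rewrite [in RHS]big_ltn ?(prim_order_gt0 prim_z) // coefD.
  rewrite [in RHS]big1 ?coef0 ?add0r.
    rewrite coef_sum; apply: eq_bigr => j _; rewrite -coefZ.
    apply: (congr1 (fun P : {poly F} => P`_n)).
    rewrite /E scalerA scaler_sumr;
      apply: eq_bigr => k _; rewrite scalerA; congr (_ *: _).
    by rewrite !exprS; ring.
  by move=> k _; rewrite expr0 !expr1n subrr scale0r.
rewrite exchange_big /=; apply: (congr1 (fun P : {poly F} => P`_n)).
under eq_bigr do rewrite -scaler_suml sumrB !sum_root_powers.
(* Only k = p - 2 and k = p - 1 survive; they give p (X + 1) - p. *)
case: (p) p_gt1 => [|[|m]] // _; rewrite !big_ord_recr /= subnn subSnn big1 => [|i _].
  have -> : (m.+2 %| m.+3)%N = false by rewrite -[m.+3]addn1 dvdn_addr // gtnNdvd.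
  have -> : (m.+2 %| m.+1)%N = false by rewrite gtnNdvd.
  rewrite !dvdnn !mulr0n !mulr1n add0r subr0 sub0r expr1 expr0 scalerDr scaleNr.
  by rewrite addrK.
by rewrite !gtnNdvd ?subrr ?scale0r //; have := ltn_ord i; lia.
Qed.

(** Over the common denominator (1 - v^p)^2 the numerator is a double sum of (v z^i)^(k+l+1).
    Summing over [i] leaves k + l + 1 = p, the only multiple of p in range. *)
Lemma sum_root_frac v : v ^+ p != 1 ->
  \sum_(0 <= i < p) v * z ^+ i / (1 - v * z ^+ i) ^+ 2
  = p%:R ^+ 2 * v ^+ p / (1 - v ^+ p) ^+ 2.
Proof.
move=> vp; have nzp : 1 - v ^+ p != 0 by rewrite subr_eq0 eq_sym.
have fac i : 1 - v ^+ p = (1 - v * z ^+ i) * \sum_(k < p) (v * z ^+ i) ^+ k.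
  apply: oppr_inj; rewrite -mulNr !opprB -subrX1 exprMn exprAC.
  by rewrite (prim_expr_order prim_z) expr1n mulr1.
rewrite (eq_bigr (fun i => (\sum_(k < p) \sum_(l < p)
    v ^+ (k + l).+1 * (z ^+ i) ^+ (k + l).+1) / (1 - v ^+ p) ^+ 2)); last first.
  move=> i _; have := nzp; rewrite [in X in X -> _](fac i) mulf_eq0 => /norP[nz1 nz2].
  have -> : \sum_(k < p) \sum_(l < p) v ^+ (k + l).+1 * (z ^+ i) ^+ (k + l).+1
    = v * z ^+ i * (\sum_(k < p) (v * z ^+ i) ^+ k) ^+ 2.
    rewrite expr2 mulr_suml mulr_sumr; apply: eq_bigr => k _.
    rewrite !mulr_sumr; apply: eq_bigr => l _.
    by rewrite -exprMn -exprD -exprS.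
  by rewrite (fac i); field; rewrite nz1 nz2.
rewrite -mulr_suml; congr (_ / _).
rewrite exchange_big /= (eq_bigr (fun=> p%:R * v ^+ p)).
  by rewrite sumr_const card_ord -[LHS]mulr_natl mulrA expr2.
move=> k _; rewrite exchange_big /=.
under eq_bigr do rewrite -mulr_sumr sum_root_powers.
have lt_p : (p - k.+1 < p)%N by have := ltn_ord k; lia.
rewrite (bigD1 (Ordinal lt_p)) //= big1 => [|l /eqP ne].
  have -> : (k + (p - k.+1)).+1 = p by have := ltn_ord k; lia.
  by rewrite dvdnn addr0 mulrC.
case: dvdnP => [[q]|_]; last by rewrite mulr0.
move=> klq; case: ne; apply: val_inj => /=.
by move: klq (ltn_ord k) (ltn_ord l); case: q => [|[|q]]; rewrite ?mulSn; lia.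
Qed.

End RootSums.

(** * Evaluation of the dual sums *)

(** In characteristic zero the natural numbers supply more roots than the degree allows. *)
Lemma horner_eq0 (F : numFieldType) (P : {poly F}) :
  (forall u, P.[u] = 0) -> P = 0.
Proof.
move=> P0; apply/eqP; apply: contraT => nzP.
have := @max_poly_roots _ P [seq i%:R | i <- iota 0 (size P)] nzP.
rewrite size_map size_iota ltnn; apply.
  by apply/allP => u _; apply/rootP.
by rewrite map_inj_uniq ?iota_uniq //; apply: mulrIn; rewrite oner_eq0.
Qed.

(** The range is padded up to [N] by zero binomials, so that expansions with different [n] share one
    index set. *)
Lemma binomial_sub1 (F : fieldType) (x : F) m n N : (n <= N)%N ->
  \sum_(0 <= j < N.+1) 'C(n, j)%:R * (-1) ^+ j * x ^+ (m + n - j)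
  = x ^+ m * (x - 1) ^+ n.
Proof.
move=> nN; rewrite (@big_cat_nat _ _ _ n.+1) //= [X in _ + X]big_nat_cond.
rewrite [X in _ + X]big1 => [|j]; last first.
  by rewrite andbT => /andP[nj _]; rewrite bin_small // !mul0r.
rewrite addr0 exprBn mulr_sumr big_mkord; apply: eq_bigr => j _.
rewrite expr1n mulr1 mulrnAr -addnBA ?exprD; last by rewrite -ltnS.
by rewrite -mulr_natl; ring.
Qed.

Section Homogeneous.

Variables (F : numClosedFieldType) (p : nat) (z : F).
Hypotheses (prim_z : p.-primitive_root z) (p_gt1 : (1 < p)%N).

(** With alternating signs, both sequences multiply (X + 1)^p - 1 to p X. Splitting off X leaves a
    factor with constant term p, which [conv_inj] cancels. *)
Lemma is_Kseq_rootsum (K : nat -> rat) n : is_Kseq p K -> ratr (K n) = rootsum z p n.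
Proof.
move=> HK.
pose D : {poly F} := \sum_(i < p) ('X + 1) ^+ i.
have DE : ('X + 1) ^+ p - 1 = 'X * D by rewrite subrX1 addrK.
suff /(_ n) : (fun n => (-1) ^+ n.+1 * ratr (K n)) =1
              (fun n => (-1) ^+ n.+1 * rootsum z p n).
  by apply: mulfI; rewrite signr_eq0.
apply: (conv_inj _ _ _ D).
  rewrite -horner_coef0 horner_sum (eq_bigr (fun=> 1)) => [|i _].
    by rewrite sumr_const card_ord pnatr_eq0; lia.
  by rewrite !hornerE ?add0r expr1n.
move=> {}n; rewrite -[LHS]convXM -[RHS]convXM -DE rootsum_expansion // coefZ coefX mulr_natr.
have /(congr1 (@ratr F)) := HK n.+1.
rewrite Kseq_coefN rmorphMn /= ratr_nat => ->; rewrite rmorph_sum /=.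
apply: eq_bigr => i _.
rewrite !rmorphM /= rmorphXn rmorphN1; congr (_ * _).
rewrite -coef_map map_comp_poly !rmorphB /= !rmorphXn /= rmorphD /= map_polyX map_polyC /=.
by rewrite !rmorph1 comp_polyX.
Qed.

Local Notation rw := (fun k => rx z k * ry z k).

Lemma prod_sub_roots v :
  (v - 1) * \prod_(1 <= i < p) (v - z ^+ i) = v ^+ p - 1.
Proof.
have := factor_Xn_sub_1 prim_z; rewrite big_ltn ?(prim_order_gt0 prim_z) //.
move=> /(congr1 (fun P => P.[v])); rewrite !hornerE ?hornerXn horner_prod expr0.
by move=> <-; congr (_ * _); apply: eq_bigr => i _; rewrite !hornerE.
Qed.

Lemma prod_1sub_roots : \prod_(1 <= i < p) (1 - z ^+ i) = p%:R.
Proof.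
have : \prod_(1 <= i < p) ('X - (z ^+ i)%:P) = \sum_(i < p) 'X^i :> {poly F}.
  apply: (mulfI (_ : 'X - 1%:P != 0)); first by rewrite polyXsubC_eq0.
  rewrite [in RHS]polyC1 -subrX1 -(factor_Xn_sub_1 prim_z).
  by rewrite [in RHS]big_ltn ?(prim_order_gt0 prim_z) // expr0.
move=> /(congr1 (fun P => P.[1])); rewrite horner_prod horner_sum.
rewrite (eq_bigr (fun i => 1 - z ^+ i)) => [->|i _]; last by rewrite !hornerE.
rewrite (eq_bigr (fun=> 1)) => [|i _]; last by rewrite hornerXn expr1n.
by rewrite sumr_const card_ord.
Qed.

(** By [conv_iter_psum], 1 / W is the generating function of the homogeneous sums h_n of the x_k
    y_k. *)
Let W : {poly F} := \prod_(1 <= k < p) (1 - rw k *: 'X).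
Let W' i : {poly F} := \prod_(1 <= k < p | k != i) (1 - rw k *: 'X).

Lemma prodD1 i : (0 < i < p)%N -> W = (1 - rw i *: 'X) * W' i.
Proof.
by move=> ip; rewrite /W (bigD1_seq i) ?iota_uniq // mem_index_iota.
Qed.

(** Here x_k y_k = z^k / (1 - z^k)^2, and (v - 1)^2 / v = v + 1/v - 2 is symmetric in v and 1/v. *)
Lemma one_sub_rw v k : v != 0 -> (0 < k < p)%N ->
  1 - rw k * ((v - 1) ^+ 2 / v)
  = (v - z ^+ k) * (v^-1 - z ^+ k) / (1 - z ^+ k) ^+ 2.
Proof.
move=> v0 kp; have nz := subr_expr_neq0 _ _ _ prim_z k kp.
rewrite (ryE _ _ _ prim_z) // /rx; field; by rewrite nz v0.
Qed.

(* Under [U = (v - 1)^2 / v] each factor [1 - rw k * U] splits into linear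
   factors in [v], and the identity reduces to the partial fraction expansion
   [sum_root_frac] at [v] and at [1 / v]. *)
Lemma homogeneous_poly :
  2 *: W ^+ 2 + \sum_(1 <= i < p) (rw i *: ('X * (2%:P + (2 * rw i + 1) *: 'X))) * W' i ^+ 2
  = 2 *: W.
Proof.
apply/eqP; rewrite -subr_eq0; set A := (X in X == 0).
have WE u : W.[u] = \prod_(1 <= k < p) (1 - rw k * u).
  by rewrite horner_prod; apply: eq_bigr => k _; rewrite !hornerE.
have W0 : W != 0.
  apply: contra_eq_neq (WE 0) => /= ->; rewrite horner0 eq_sym big1 ?oner_eq0 // => k _.
  by rewrite mulr0 subr0.
(* The factor X W removes from consideration u = 0 and the zeros of W, where the partial fractions
   have poles. *)
suff /horner_eq0/eqP : forall u, ('X * W * A).[u] = 0.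
  by rewrite !mulf_eq0 polyX_eq0 (negPf W0).
move=> u; rewrite !hornerM hornerX.
have [->|u0] := eqVneq u 0; first by rewrite !mul0r.
have [->|Wu] := eqVneq W.[u] 0; first by rewrite mulr0 mul0r.
suff -> : A.[u] = 0 by rewrite mulr0.
(* Such a [v] solves v^2 - (u + 2) v + 1 = 0; the square root of the discriminant exists in a closed
   field. *)
have [v v0 uE] : exists2 v : F, v != 0 & u = (v - 1) ^+ 2 / v.
  pose s := sqrtC ((u + 2) ^+ 2 - 4); have sE : s ^+ 2 = (u + 2) ^+ 2 - 4 by rewrite sqrtCK.
  pose v := (u + 2 + s) / 2.
  have vE : v ^+ 2 = (u + 2) * v - 1.
    rewrite /v; have n2 : 2 != 0 :> F by rewrite pnatr_eq0.
    have -> : ((u + 2 + s) / 2) ^+ 2 = ((u + 2) ^+ 2 + 2 * (u + 2) * s + s ^+ 2) / 4 by field.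
    by rewrite sE; field.
  have v0 : v != 0.
    by apply: contra_eq_neq vE => ->; rewrite mulr0 expr0n sub0r eq_sym oppr_eq0 oner_eq0.
  exists v => //; apply: (canRL (mulfK v0)).
  by rewrite sqrrB1 vE; ring.
have v1 : v - 1 != 0 by apply: contraNneq u0; rewrite uE => ->; rewrite expr0n mul0r.
have fac k : (0 < k < p)%N ->
    [/\ 1 - rw k * u != 0, v - z ^+ k != 0 & 1 - v * z ^+ k != 0].
  move=> kp; have : 1 - rw k * u != 0.
    apply: contraNneq Wu => e; rewrite WE (bigD1_seq k) ?iota_uniq ?mem_index_iota //=.
    by rewrite e mul0r.
  move=> nz; split=> //; move: nz; rewrite uE one_sub_rw // !mulf_eq0 !negb_or.
    by case/andP => /andP[].
  case/andP => /andP[_ nz _]; move: nz; apply: contraNneq => e.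
  by apply/eqP/(mulfI v0); rewrite mulrBr mulfV // mulr0.
have vp : v ^+ p != 1.
  rewrite -subr_eq0 -prod_sub_roots mulf_neq0 //.
  by rewrite prodf_seq_neq0; apply/allP => k; rewrite mem_index_iota => /fac[].
have vV1 : v^-1 - 1 != 0 by rewrite subr_eq0 -(inj_eq invr_inj) invrK invr1 -subr_eq0.
have W_v : W.[u] = (v ^+ p - 1) / (v - 1) * ((v^-1 ^+ p - 1) / (v^-1 - 1)) / p%:R ^+ 2.
  rewrite WE -!prod_sub_roots ![_ * \prod_(_ <= _ < _) _]mulrC !mulfK //.
  rewrite -prod_1sub_roots expr2 invfM -prodfV -!big_split /=.
  by apply: eq_big_nat => k kp; rewrite uE one_sub_rw // expr2 invfM.
(* Each summand is v z^i / (1 - v z^i)^2 plus the same term at 1/v. The two full sums agree, as do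
   their i = 0 terms, hence the factor 2. *)
have sum_v : \sum_(1 <= i < p) rw i * (2 + (2 * rw i + 1) * u) / (1 - rw i * u) ^+ 2
   = 2 * (p%:R ^+ 2 * v ^+ p / (1 - v ^+ p) ^+ 2 - v / (1 - v) ^+ 2).
  have vVp : v^-1 ^+ p != 1 by rewrite exprVn -(inj_eq invr_inj) invrK invr1.
  have sumV : p%:R ^+ 2 * v^-1 ^+ p / (1 - v^-1 ^+ p) ^+ 2
      = p%:R ^+ 2 * v ^+ p / (1 - v ^+ p) ^+ 2.
    have vp0 : v ^+ p != 0 by rewrite expf_neq0.
    have nz : 1 - v ^+ p != 0 by rewrite subr_eq0 eq_sym.
    have nz' : v ^+ p - 1 != 0 by rewrite subr_eq0.
    rewrite exprVn; field; by rewrite nz vp0 nz'.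
  have v1' : 1 - v != 0 by rewrite -opprB oppr_eq0.
  have term : v^-1 * z ^+ 0 / (1 - v^-1 * z ^+ 0) ^+ 2 = v / (1 - v) ^+ 2.
    rewrite expr0; field; by rewrite v1' v0 v1.
  have term' : v * z ^+ 0 / (1 - v * z ^+ 0) ^+ 2 = v / (1 - v) ^+ 2.
    by rewrite expr0 !mulr1.
  have p0 := prim_order_gt0 prim_z.
  have s1 := sum_root_frac _ _ _ prim_z _ vp.
  have s2 := sum_root_frac _ _ _ prim_z _ vVp.
  rewrite big_ltn // term' in s1; rewrite sumV big_ltn // term in s2.
  transitivity (\sum_(1 <= i < p) v * z ^+ i / (1 - v * z ^+ i) ^+ 2
      + \sum_(1 <= i < p) v^-1 * z ^+ i / (1 - v^-1 * z ^+ i) ^+ 2); last first.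
    by rewrite (canRL (addKr _) s1) (canRL (addKr _) s2); ring.
  rewrite -big_split /=.
  apply: eq_big_nat => k kp; have [f1 f2 f3] := fac k kp.
  have nz := subr_expr_neq0 _ _ _ prim_z k kp.
  move: f1; rewrite uE one_sub_rw // => f1.
  rewrite (ryE _ _ _ prim_z) // /rx.
  have f4 : v^-1 - z ^+ k != 0 by move: f1; rewrite !mulf_eq0 !negb_or => /andP[/andP[]].
  by field; rewrite v0 f2 f3 nz.
rewrite /A !(hornerD, hornerN, hornerZ, horner_exp) horner_sum.
rewrite (eq_big_nat _ _ (F2 := fun i => (u * W.[u] ^+ 2) *
  (rw i * (2 + (2 * rw i + 1) * u) / (1 - rw i * u) ^+ 2))); last first.
  move=> i ip; have [f1 _ _] := fac i ip.
  have -> : W.[u] = (1 - rw i * u) * (W' i).[u] by rewrite (prodD1 i ip) !hornerE.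
  by rewrite !(hornerM, hornerD, hornerZ, hornerC, hornerX, horner_exp); field.
(* The subtracted term v / (1 - v)^2 is 1/u and cancels the leading 2 W^2; the rest is the value
   [W_v]. *)
rewrite -mulr_sumr sum_v W_v uE exprVn.
have p_neq0 : p%:R != 0 :> F by rewrite pnatr_eq0; lia.
have vp0 : v ^+ p != 0 by rewrite expf_neq0.
have v1' : 1 - v != 0 by rewrite -opprB oppr_eq0.
have nz' : 1 - v ^+ p != 0 by rewrite subr_eq0 eq_sym.
by field; rewrite p_neq0 v0 mulN1r v1' vp0 v1 nz'.
Qed.

(** Division of [homogeneous_poly] by W^2 makes its right side 2 / W; coefficients of X^(t+1) are
    then compared. In the proof, [s i] lists the coefficients of w X (2 + (2 w + 1) X) / (1 - w X)^2
    with w = x_i y_i. *)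
Lemma iter_psum_rw t :
  2 * iter t.+1 (psum rw) (fun=> 1) p.-1
  = \sum_(1 <= i < p) ((4 * t + 2)%:R * rw i ^+ t.+1 + t%:R * rw i ^+ t).
Proof.
pose s i n := if n is m.+1 then (4 * m + 2)%:R * rw i ^+ m.+1 + m%:R * rw i ^+ m else 0.
pose c n := 2 * iter n (psum rw) (fun=> 1) p.-1.
pose d n := 2 * (1 : {poly F})`_n + \sum_(1 <= i < p) s i n.
have W0 : W`_0 != 0.
  rewrite -horner_coef0 horner_prod big1 ?oner_eq0 // => k _.
  by rewrite !hornerE ?mulr0 ?subr0.
suff cd : c =1 d by rewrite -[LHS]/(c t.+1) cd /d coef1 mulr0 add0r.
(* Two cancellations, because the double poles put W^2 in the denominator. *)
apply: (conv_inj _ _ _ _ W0); apply: (conv_inj _ _ _ _ W0) => n.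
have cW k : conv c W k = 2 * (1 : {poly F})`_k.
  rewrite convZ coef1 -(conv_iter_psum _ rw p.-1) prednK //; exact: ltnW.
rewrite (eq_conv _ _ _ _ _ (fun k _ => cW k)) convZ conv_coef mul1r.
rewrite -convM convD convZ conv_coef mul1r conv_sum -coefZ -homogeneous_poly.
rewrite coefD coefZ expr2 coef_sum; congr (_ + _).
apply: eq_big_nat => i ip; rewrite {1 2}(prodD1 i ip).
have -> : (1 - rw i *: 'X) * W' i * ((1 - rw i *: 'X) * W' i)
  = (1 - rw i *: 'X) * (1 - rw i *: 'X) * W' i ^+ 2 by ring.
rewrite convM -conv_coef; apply: eq_conv => k _.
rewrite convM !conv_1subX.
case: k => [|[|[|k]]]; rewrite /= ?conv_1subX /= coefZ coefXM /=
  ?coefD ?coefC ?coefZ ?coefX /=; rewrite ?exprS ?expr0; ring.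
Qed.

Lemma iter_psum_rootsum t : (0 < t)%N ->
  iter t (psum rw) (fun=> 1) p.-1
  = \sum_(0 <= j < t.+1) (t%:R * 'C(t - 1, j)%:R + (t%:R - 1) * 'C(t, j)%:R)
      * (-1) ^+ j * rootsum z p (2 * t - j).
Proof.
case: t => // t _; rewrite subSS subn0.
have two_nz : 2 != 0 :> F by rewrite pnatr_eq0.
(* Twice the new sum is itself plus its reflection under i -> p - i, which turns y^2 into x^2; then
   x^2 + y^2 = 1 + 2 x y because x - y = 1. *)
transitivity (\sum_(1 <= i < p) (t.+1%:R * rw i ^+ t.+1 + t%:R * rw i ^+ t * ry z i ^+ 2)).
  apply: (mulfI two_nz); rewrite iter_psum_rw mulr_natl mulr2n.
  rewrite [X in _ = _ + X]big_nat_rev -big_split; apply: eq_big_nat => i ip.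
  rewrite /= add1n subSS (rx_rev _ _ _ prim_z) // (ry_rev _ _ _ prim_z) //.
  rewrite mulrNN sqrrN [ry z i * rx z i]mulrC natrD natrM -natr1 [rw i ^+ t.+1]exprS /ry.
  by ring.
under [RHS]eq_bigr do rewrite mulr_sumr.
rewrite exchange_big_nat; apply: eq_big_nat => i ip /=.
(* One y is traded for z^i x, the weight of [rootsum]; the remaining powers of y = x - 1 are
   expanded binomially. *)
transitivity (t.+1%:R * (z ^+ i * (rx z i ^+ t.+2 * (rx z i - 1) ^+ t))
    + t%:R * (z ^+ i * (rx z i ^+ t.+1 * (rx z i - 1) ^+ t.+1))).
  have -> : z ^+ i * (rx z i ^+ t.+2 * (rx z i - 1) ^+ t) = rw i ^+ t.+1.
    rewrite -/(ry z i) exprMn [ry z i ^+ t.+1]exprS {2}(ryE _ _ _ prim_z) // exprS; ring.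
  have -> : z ^+ i * (rx z i ^+ t.+1 * (rx z i - 1) ^+ t.+1) = rw i ^+ t * ry z i ^+ 2.
    rewrite -/(ry z i) exprMn expr2 {3}(ryE _ _ _ prim_z) // !exprS; ring.
  by rewrite -(mulrA t%:R).
rewrite -(binomial_sub1 _ _ _ _ t.+1 (leqnSn t)) -(binomial_sub1 _ _ _ _ t.+1 (leqnn _)).
rewrite !mulr_sumr -big_split /=; apply: eq_bigr => j _.
have -> : (t.+2 + t = 2 * t.+1)%N by lia.
have -> : (t.+1 + t.+1 = 2 * t.+1)%N by lia.
by rewrite -[in RHS]natr1; ring.
Qed.

End Homogeneous.

(** * Values of rational functions at a root of unity *)

Lemma wsum_sum (F : fieldType) (phi : nat -> nat -> F) (I : Type) (r : seq I)
    (P : pred I) (c : I -> F) (f : I -> nat -> F) s m : (0 < m)%N ->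
  wsum phi (fun k => \sum_(i <- r | P i) c i * f i k) s m
  = \sum_(i <- r | P i) c i * wsum phi (f i) s m.
Proof.
move=> m0; elim: s f => //= s0 s IHs f; rewrite -IHs; apply: eq_wsum => // k _.
rewrite /psum (eq_bigr (fun j => \sum_(i <- r | P i) c i * (phi s0 j * f i j))).
  by rewrite exchange_big; apply: eq_bigr => i _; rewrite mulr_sumr.
by move=> j _; rewrite mulr_sumr; apply: eq_bigr => i _; rewrite mulrCA.
Qed.

(* [qS n s] is [tsum qterm n 1 s], with [qterm] below. *)
Definition tsum {F : fieldType} (phi : nat -> nat -> F) (n lo : nat) (s : seq nat) : F :=
  \sum_(k : (size s).-tuple 'I_n.+1 | path leq lo [seq val x | x <- k])
    \prod_(i < size s) phi (nth 0%N s i) (tnth k i).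

Lemma tsum_cons (F : fieldType) (phi : nat -> nat -> F) n lo s0 s :
  tsum phi n lo (s0 :: s)
  = \sum_(k < n.+1 | (lo <= k)%N) phi s0 k * tsum phi n k s.
Proof.
rewrite /tsum /=; under [RHS]eq_bigr do rewrite mulr_sumr.
rewrite pair_big_dep /=.
rewrite (reindex (fun u : 'I_n.+1 * (size s).-tuple 'I_n.+1 => cons_tuple u.1 u.2)) /=.
  apply: eq_bigr => -[k t] _ /=; rewrite big_ord_recl /= tnth0; congr (_ * _).
  by apply: eq_bigr => i _; rewrite tnthS.
exists (fun t => (thead t, behead_tuple t)) => [[k t]|t] _ /=.
  by congr pair; apply: val_inj.
by rewrite [RHS]tuple_eta; apply: val_inj.
Qed.

(** Both sides unfold from the smallest index. The lower bound travels as an indicator seed: summing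
    phi k [k <= m] over k >= lo is [psum] of the indicator of lo. *)
Lemma tsum_wsum (F : fieldType) (phi : nat -> nat -> F) n lo s : (0 < lo <= n)%N ->
  tsum phi n lo s = wsum phi (fun m => (lo <= m)%N%:R) s n.
Proof.
elim: s lo => [|s0 s IHs] lo /andP[lo0 lon].
  rewrite /tsum /= lon (big_pred1 [tuple]) ?big_ord0 // => t.
  by rewrite (tuple0 t) /=; apply/esym/eqP.
rewrite tsum_cons (eq_bigr (fun k : 'I_n.+1 =>
   phi s0 k * wsum phi (fun m => (k <= m)%N%:R) s n)) => [|k lok]; last first.
  by rewrite IHs //; have := ltn_ord k; lia.
have n0 : (0 < n)%N by lia.
rewrite -wsum_sum //=; apply: eq_wsum => // m mn.
rewrite -(big_mkord (fun k => lo <= k)%N (fun k => phi s0 k * (k <= m)%N%:R)).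
rewrite /psum big_mkcond /= big_ltn // leqNgt lo0 /= add0r.
rewrite (@big_cat_nat _ _ _ m.+1) //=; [|lia].
rewrite [X in _ + X]big_nat_cond [X in _ + X]big1 ?addr0.
  apply: eq_big_nat => k km; have -> : (k <= m)%N by lia.
  by case: ifP => _; rewrite ?mulr1 ?mulr0.
move=> k; rewrite andbT => km; have -> : (k <= m)%N = false by lia.
by rewrite mulr0 if_same.
Qed.

Section Eval.

Variable z : algC.

Definition ieval (f : {poly int}) : algC := (map_poly intr f).[z].

Lemma ievalD f g : ieval (f + g) = ieval f + ieval g.
Proof. by rewrite /ieval rmorphD hornerD. Qed.

Lemma ievalM f g : ieval (f * g) = ieval f * ieval g.
Proof. by rewrite /ieval rmorphM hornerM. Qed.

(* The rational function [A] has no pole at [z] and takes the value [v] there. *)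
Definition evals (A : ratfun) (v : algC) : Prop :=
  exists f g : {poly int},
    [/\ A = polyF (intpoly f) / polyF (intpoly g), ieval g != 0
      & v = ieval f / ieval g].

Lemma polyF_neq0 g : ieval g != 0 -> polyF (intpoly g) != 0.
Proof.
apply: contraNneq => /eqP; rewrite tofrac_eq0 => /eqP g0.
rewrite /ieval; suff -> : g = 0 by rewrite rmorph0 horner0.
by apply: (map_inj_poly (@intr_inj rat) (erefl _)); rewrite -/(intpoly g) g0 rmorph0.
Qed.

Lemma polyFM f g : polyF (intpoly (f * g)) = polyF (intpoly f) * polyF (intpoly g).
Proof. by rewrite /polyF /intpoly !rmorphM. Qed.

Lemma polyFD f g : polyF (intpoly (f + g)) = polyF (intpoly f) + polyF (intpoly g).
Proof. by rewrite /polyF /intpoly !rmorphD. Qed.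

Lemma polyF1 : polyF (intpoly 1) = 1.
Proof. by rewrite /polyF /intpoly !rmorph1. Qed.

Lemma ieval1 : ieval 1 = 1.
Proof. by rewrite /ieval rmorph1 hornerC. Qed.

Lemma evals_polyF f : evals (polyF (intpoly f)) (ieval f).
Proof. by exists f, 1; split; rewrite ?polyF1 ?ieval1 ?divr1 ?oner_eq0. Qed.

Lemma evalsD A B v w : evals A v -> evals B w -> evals (A + B) (v + w).
Proof.
move=> [f [g [-> g0 ->]]] [f' [g' [-> g0' ->]]]; exists (f * g' + f' * g), (g * g').
rewrite ievalM mulf_neq0 // ievalD !ievalM polyFD !polyFM.
by rewrite !addf_div ?polyF_neq0.
Qed.

Lemma evalsM A B v w : evals A v -> evals B w -> evals (A * B) (v * w).
Proof.
move=> [f [g [-> g0 ->]]] [f' [g' [-> g0' ->]]]; exists (f * f'), (g * g').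
by rewrite !ievalM mulf_neq0 // !polyFM !mulf_div.
Qed.

Lemma evalsV A v : v != 0 -> evals A v -> evals A^-1 v^-1.
Proof.
move=> v0 [f [g [-> g0 vE]]]; exists g, f; rewrite vE !invf_div; split=> //.
by apply: contraNneq v0 => f0; rewrite vE f0 mul0r.
Qed.

Lemma evals0 : evals 0 0.
Proof. by have := evals_polyF 0; rewrite /polyF /intpoly /ieval !rmorph0 horner0. Qed.

Lemma evals1 : evals 1 1.
Proof. by have := evals_polyF 1; rewrite polyF1 ieval1. Qed.

Lemma evalsN A v : evals A v -> evals (- A) (- v).
Proof.
move=> Av; rewrite -mulN1r -[- v]mulN1r; apply: evalsM => //.
have := evals_polyF (-1); rewrite /polyF /intpoly /ieval !rmorphN1.
by rewrite -polyCN hornerC.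
Qed.

Lemma evalsX A v n : evals A v -> evals (A ^+ n) (v ^+ n).
Proof.
by move=> Av; elim: n => [|n IHn]; rewrite ?exprS; [exact: evals1 | exact: evalsM].
Qed.

Lemma evals_sum (I : Type) (r : seq I) (P : pred I) (A : I -> ratfun) (v : I -> algC) :
  (forall i, P i -> evals (A i) (v i)) ->
  evals (\sum_(i <- r | P i) A i) (\sum_(i <- r | P i) v i).
Proof. by move=> Av; apply: big_ind2 => //; [exact: evals0 | move=> *; exact: evalsD]. Qed.

Lemma evals_prod (I : Type) (r : seq I) (P : pred I) (A : I -> ratfun) (v : I -> algC) :
  (forall i, P i -> evals (A i) (v i)) ->
  evals (\prod_(i <- r | P i) A i) (\prod_(i <- r | P i) v i).
Proof. by move=> Av; apply: big_ind2 => //; [exact: evals1 | move=> *; exact: evalsM]. Qed.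

Lemma evals_qvar : evals qvar z.
Proof.
by have := evals_polyF 'X; rewrite /ieval /intpoly !map_polyX hornerX.
Qed.

Lemma evals_constF c : evals (constF c) (ratr c).
Proof.
exists (numq c)%:P, (denq c)%:P; rewrite /ieval /intpoly !map_polyC !hornerC /=.
have d0 : (denq c)%:~R != 0 :> rat by rewrite intr_eq0 denq_neq0.
split=> //; last by rewrite intr_eq0 denq_neq0.
apply: (canRL (mulfK _)); first by rewrite tofrac_eq0 polyC_eq0.
by rewrite /constF /polyF -tofracM -polyCM -{1}(divq_num_den c) divfK.
Qed.

End Eval.

(** * Divisibility by [p]_q as vanishing at a primitive root *)

Lemma ievalE z f : ieval z f = (map_poly ratr (intpoly f)).[z].
Proof.
rewrite /ieval /intpoly -map_poly_comp; congr (_.[z]).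
by apply: eq_map_poly => c /=; rewrite ratr_int.
Qed.

Lemma qbracket_geom p : qbracket p * ('X - 1) = 'X^p - 1.
Proof. by rewrite subrX1 mulrC. Qed.

Lemma size_qbracket p : size (qbracket p) = p.
Proof.
have [->|p0] := posnP p; first by rewrite /qbracket big_ord0 size_poly0.
have : size (qbracket p * ('X - 1%:P)) = p.+1.
  by rewrite polyC1 qbracket_geom -polyC1 size_XnsubC.
rewrite size_Mmonic ?monicXsubC ?size_XsubC ?addn2 //=; first by case.
apply: contra_eqN (qbracket_geom p) => /eqP ->.
by rewrite mul0r eq_sym -size_poly_eq0 -polyC1 size_XnsubC.
Qed.

Lemma qbracket_monic p : (0 < p)%N -> qbracket p \is monic.
Proof.
move=> p0; rewrite -(monicMr _ (monicXsubC 1)) polyC1 qbracket_geom.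
by rewrite -polyC1 monicXnsubC.
Qed.

Section Minimal.

Variables (p : nat) (z : algC).
Hypotheses (p_prime : prime p) (prim_z : p.-primitive_root z).

Lemma ieval_qbracket k : ieval z (qbracket k) * (1 - z) = 1 - z ^+ k.
Proof.
rewrite -[1 - z]opprB -[1 - z ^+ k]opprB mulrN; congr (- _).
have := congr1 (ieval z) (qbracket_geom k); rewrite ievalM /ieval !rmorphB /=.
by rewrite map_polyX map_polyXn !rmorph1 !hornerE ?hornerXn.
Qed.

Lemma ieval_qbracket0 : ieval z (qbracket p) = 0.
Proof.
apply: (mulIf (subr_expr_neq0 _ _ _ prim_z 1 _)); first by rewrite prime_gt1.
by rewrite expr1 ieval_qbracket (prim_expr_order prim_z) subrr mul0r.
Qed.

Lemma size_intpoly f : size (intpoly f) = size f.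
Proof. exact/size_map_inj_poly/erefl/intr_inj. Qed.

(** The minimal polynomial of z divides [p]_q, and as the p-th cyclotomic polynomial it has the same
    degree p - 1. *)
Lemma root_qbracket (f : {poly rat}) :
  root (map_poly ratr f) z = (intpoly (qbracket p) %| f).
Proof.
have [q [qE q_monic] qP] := minCpolyP z; rewrite qP; apply: eqp_dvdl.
have qb : q %| intpoly (qbracket p) by rewrite -qP rootE -ievalE ieval_qbracket0.
rewrite -(dvdp_size_eqp qb) size_intpoly size_qbracket.
rewrite -(size_map_poly (@ratr algC)) -qE (minCpoly_cyclotomic prim_z).
by rewrite size_cyclotomic totient_prime ?prednK ?prime_gt0.
Qed.

Lemma ieval_eq0 f : (ieval z f == 0) = (intpoly (qbracket p) %| intpoly f).
Proof. by rewrite ievalE -rootE root_qbracket. Qed.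

(** If [p]_q = e d with d the gcd, then z is a root of d or of e. The first would make [p]_q divide
    [g]; the second gives e full degree, so d is constant. *)
Lemma coprimep_qbracket g : ieval z g != 0 -> coprimep (intpoly g) (intpoly (qbracket p)).
Proof.
rewrite ieval_eq0 /coprimep => ndiv; set d := gcdp _ _.
have qb0 : intpoly (qbracket p) != 0.
  by rewrite -size_poly_eq0 size_intpoly size_qbracket -lt0n prime_gt0.
have /dvdpP [e eE] : d %| intpoly (qbracket p) by exact: dvdp_gcdr.
have := dvdpp (intpoly (qbracket p)); rewrite -root_qbracket {1}eE rmorphM rootM /=.
rewrite !root_qbracket orbC => /orP[/dvdp_trans dv | dv].
  by rewrite dv ?dvdp_gcdl in ndiv.
move: qb0; rewrite eE mulf_eq0 negb_or => /andP[e0 d0].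
have := dvdp_leq e0 dv; rewrite eE size_mul //.
have : (0 < size e)%N by rewrite size_poly_gt0.
have : (0 < size d)%N by rewrite size_poly_gt0.
by move: (size e) (size d) => m n; lia.
Qed.

(** As [p]_q is monic, division with remainder stays over the integers. The remainder vanishes at z
    and has too small a degree to be nonzero. *)
Lemma eqmod_evals A B v : evals z A v -> evals z B v -> eqmod_qbracket p A B.
Proof.
move=> Av Bv; have [f [g [ABE g0 vE]]] := evalsD _ _ _ _ _ Av (evalsN _ _ _ Bv).
have f0 : ieval z f = 0.
  by apply: (mulIf (_ : (ieval z g)^-1 != 0)); rewrite ?invr_eq0 // -vE subrr mul0r.
have qb_monic := qbracket_monic p (prime_gt0 p_prime).
exists f, g, (Pdiv.Ring.rdivp f (qbracket p)); split=> //; first exact: coprimep_qbracket.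
have fE := Pdiv.RingMonic.rdivp_eq qb_monic f.
suff r0 : Pdiv.Ring.rmodp f (qbracket p) = 0 by rewrite {1}fE r0 addr0 mulrC.
have : intpoly (qbracket p) %| intpoly (Pdiv.Ring.rmodp f (qbracket p)).
  rewrite -ieval_eq0; move: f0; rewrite {1}fE ievalD ievalM ieval_qbracket0 mulr0 add0r.
  by move=> ->.
have [//|r0] := eqVneq (Pdiv.Ring.rmodp f (qbracket p)) 0.
have r0' : intpoly (Pdiv.Ring.rmodp f (qbracket p)) != 0.
  by rewrite -size_poly_eq0 size_intpoly size_poly_eq0.
move=> /(dvdp_leq r0'); rewrite !size_intpoly leqNgt Pdiv.Ring.ltn_rmodp //.
by rewrite -size_poly_eq0 size_qbracket -lt0n prime_gt0.
Qed.

End Minimal.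

(** * Values of the q-sums, and the three congruences *)

Definition qterm (s k : nat) : ratfun := qvar ^+ ((s - 1) * k) / qbracketF k ^+ s.

Lemma evals_qterm p (z : algC) s k : p.-primitive_root z -> (0 < s)%N -> (0 < k < p)%N ->
  evals z (qterm s k) ((1 - z) ^+ s * letter z s k).
Proof.
move=> prim_z s0 kp; have z1 : 1 - z != 0.
  by have := subr_expr_neq0 _ _ _ prim_z 1; rewrite expr1; apply; lia.
have nz := subr_expr_neq0 _ _ _ prim_z k kp.
have qbE : ieval z (qbracket k) = (1 - z ^+ k) / (1 - z).
  by apply: (canRL (mulfK z1)); exact: ieval_qbracket.
have -> : (1 - z) ^+ s * letter z s k
    = z ^+ ((s - 1) * k) / ieval z (qbracket k) ^+ s.
  rewrite qbE -exprVn invf_div exprMn /letter (ryE _ _ _ prim_z) // exprMn -exprM mulnC.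
  by case: (s) s0 => // s' _; rewrite subSS subn0 -/(rx z k) [rx z k ^+ s'.+1]exprS; ring.
apply: evalsM; first exact/evalsX/evals_qvar.
apply: evalsV; first by rewrite expf_neq0 // qbE mulf_neq0 ?invr_eq0.
exact/evalsX/evals_polyF.
Qed.

Lemma wsum_weight (F : fieldType) (phi : nat -> nat -> F) (c : F) f s m : (0 < m)%N ->
  wsum (fun s k => c ^+ s * phi s k) f s m = c ^+ sumn s * wsum phi f s m.
Proof.
move=> m0; elim: s f => [|s0 s IHs] f /=; first by rewrite mul1r.
rewrite IHs exprD [c ^+ s0 * _]mulrC -mulrA; congr (_ * _); rewrite -wsumZ //.
apply: eq_wsum => // k _; rewrite /psum mulr_sumr.
by apply: eq_bigr => i _; rewrite mulrA.
Qed.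

Lemma evals_qS p z s : (1 < p)%N -> p.-primitive_root z -> all (leq 1) s ->
  evals z (qS p.-1 s) ((1 - z) ^+ sumn s * wsum (letter z) (fun=> 1) s p.-1).
Proof.
move=> p_gt1 prim_z s_gt0; have p1 : (0 < p.-1)%N by lia.
rewrite -wsum_weight //.
rewrite (eq_wsum _ _ _ (fun m => (1 <= m)%N%:R)) // => [|k /andP[-> _] //].
rewrite -tsum_wsum ?p1 //; apply: evals_sum => k lok; apply: evals_prod => i _.
apply: evals_qterm prim_z _ _; first by apply: (allP s_gt0); rewrite mem_nth.
have /allP/(_ (val (tnth k i))) := order_path_min leq_trans lok.
rewrite map_f ?mem_tnth // => /(_ isT) /= ->.
by rewrite (leq_trans (ltn_ord _)) // prednK // ltnW.
Qed.

Theorem theorem7p2 (a b t p : nat) (K : nat -> rat)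
    (t_gt0 : (0 < t)%N) (p_prime : prime p) (HK : is_Kseq p K) :
  [/\ ((t < p)%N ->
         eqmod_qbracket p (qS p.-1 (nseq t 1%N))
           (- constF (K t) * (1 - qvar) ^+ t)),
      ((2 * t + 1 < p)%N ->
         eqmod_qbracket p (qS p.-1 ([:: 1%N] ++ nseq (t - 1) 2%N ++ [:: 1%N]))
           ((1 - qvar) ^+ (2 * t)
            * constF (\sum_(0 <= j < t.+1)
                (t%:R * 'C(t - 1, j)%:R + (t%:R - 1) * 'C(t, j)%:R)
                * (-1) ^+ j.+1 * K (2 * t - j)%N)))
    & ((2 * (a + b + 1) + 1 < p)%N ->
         eqmod_qbracket p
           (qS p.-1 (nseq a 1%N ++ [:: 2%N] ++ nseq b 1%N)
            + qS p.-1 (nseq b 1%N ++ [:: 2%N] ++ nseq a 1%N))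
           ((1 - qvar) ^+ (a + b + 2)
            * constF (K (a + b + 1)%N - K (a + b + 2)%N
                      - K (a + 1)%N * K (b + 1)%N)))].
Proof.
have p_gt1 := prime_gt1 p_prime.
have [z prim_z] := C_prim_root_exists (prime_gt0 p_prime).
have ratK n : ratr (K n) = rootsum z p n by apply: is_Kseq_rootsum.
have ev_1q n : evals z ((1 - qvar) ^+ n) ((1 - z) ^+ n).
  apply/evalsX/evalsD; [exact: evals1 | apply/evalsN/evals_qvar].
have eqmodP := eqmod_evals p z p_prime prim_z.
have sumn_nseq n k : sumn (nseq n k) = (k * n)%N by exact: sumn_nseq.
split=> _.
- apply: (eqmodP _ _ _ (evals_qS _ _ _ p_gt1 prim_z _)); first by rewrite all_nseq orbT.
  rewrite wsum_nseq1 // -ratK sumn_nseq mul1n mulrC.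
  apply: evalsM => //; apply/evalsN/evals_constF.
- apply: (eqmodP _ _ _ (evals_qS _ _ _ p_gt1 prim_z _)).
    by rewrite !all_cat all_nseq orbT.
  rewrite (wsum_1221 _ _ _ prim_z) // (iter_psum_rootsum _ _ _ prim_z) //.
  have -> : sumn ([:: 1%N] ++ nseq (t - 1) 2%N ++ [:: 1%N]) = (2 * t)%N.
    by rewrite !sumn_cat sumn_nseq /=; lia.
  apply: evalsM => //.
  set c := \sum_(0 <= j < t.+1) _ * K _.
  suff -> : - \sum_(0 <= j < t.+1) (t%:R * 'C(t - 1, j)%:R + (t%:R - 1) * 'C(t, j)%:R)
      * (-1) ^+ j * rootsum z p (2 * t - j) = ratr c by exact: evals_constF.
  rewrite /c rmorph_sum -sumrN; apply: eq_bigr => j _.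
  rewrite !rmorphM !rmorphD !rmorphM !rmorphB !rmorph_nat rmorphXn rmorphN1 /= ratK exprS.
  by rewrite rmorph1; ring.
- apply: (eqmodP _ _ _ (evalsD _ _ _ _ _ (evals_qS _ _ _ p_gt1 prim_z _)
                                         (evals_qS _ _ _ p_gt1 prim_z _))).
    by rewrite !all_cat !all_nseq !orbT.
    by rewrite !all_cat !all_nseq !orbT.
  rewrite !sumn_cat !sumn_nseq /= !mul1n addn0.
  rewrite (_ : (b + (2 + a) = a + b + 2)%N); last lia.
  rewrite (_ : (a + (2 + b) = a + b + 2)%N); last lia.
  (* Both words have weight a + b + 2, so one power of 1 - z factors out. *)
  rewrite -mulrDr wsum_121_sym //; apply: evalsM => //.
  by rewrite -!ratK -rmorphM -!rmorphB; exact: evals_constF.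
Qed.
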